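(* Let $\mathbb{X}$ be a complex Banach space and let $T \in \mathbb{L}(\mathbb{X}, \mathbb{X}^* )$ be nonzero. Then $T$ is symmetric if and only if the following two conditions hold: (i) there exists a nonisotropic vector $x \in \mathbb{X}$; (ii) $\perp_T$ is left symmetric at $y$ for every nonisotropic vector $y \in \mathbb{X}$. The same equivalence holds with ''left symmetric'' replaced by ''right symmetric'' in (ii).
   Context: $\mathbb{X}^*$ is the dual space of $\mathbb{X}$ and $\mathbb{L}(\mathbb{X},\mathbb{X}^* )$ is the set of all bounded linear operators from $\mathbb{X}$ to $\mathbb{X}^*$. Write $(Tx,y) = Tx(y)$. For $x,y\in\mathbb{X}$, $x \perp_T y$ means $(Tx,y)=0$. The operator $T$ is symmetric if $(Tx,y)=(Ty,x)$ for all $x,y\in\mathbb{X}$. A vector $x$ is ($T$-)isotropic if $(Tx,x)=0$, and nonisotropic otherwise. The relation $\perp_T$ is left symmetric at $x$ if for each $y\in\mathbb{X}$, $x\perp_T y$ implies $y\perp_T x$; it is right symmetric at $x$ if for each $y\in\mathbb{X}$, $y\perp_T x$ implies $x\perp_T y$. *)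

(* Defs.v *)
From HB Require Import structures.
From mathcomp Require Import all_boot all_order all_algebra.
From mathcomp Require Import complex.
From mathcomp Require Import all_classical all_reals all_analysis.

Set Implicit Arguments.
Unset Strict Implicit.
Unset Printing Implicit Defensive.

Import Order.TTheory GRing.Theory Num.Theory.
Import numFieldNormedType.Exports.

Local Open Scope classical_set_scope.
Local Open Scope ring_scope.
Local Open Scope complex_scope.

Section BoundedOperators.
Context {R : realType} (V W : normedModType R[i]).
Implicit Types f g : V -> W.

Definition bounded_operator f : Prop :=
  linear f /\ exists M : R, forall x : V, `|f x| <= M%:C * `|x|.

Definition bounded_operator_pred : {pred V -> W} :=
  fun f => `[< bounded_operator f >].

Lemma bounded_operator_submod_closed : submod_closed bounded_operator_pred.
Proof.
split.
  apply/asboolP; split; first by move=> a x y; rewrite /= scaler0 addr0.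
  by exists 0 => x; rewrite normr0 mul0r.
move=> a f g /asboolP[lf [M fM]] /asboolP[lg [N gN]].
apply/asboolP; split.
  move=> b x y; change (a *: f (b *: x + y) + g (b *: x + y) =
    b *: (a *: f x + g x) + (a *: f y + g y)).
  rewrite lf lg !scalerDr !scalerA [b * a]mulrC.
  by rewrite -!addrA; congr (_ + _); rewrite addrCA.
exists (complex.Re `|a| * M + N) => x.
change (`|a *: f x + g x| <= (complex.Re `|a| * M + N)%:C * `|x|).
rewrite (le_trans (ler_normD _ _))// normrZ rmorphD rmorphM/=.
by rewrite mulrDl lerD// -mulrA ler_wpM2l.
Qed.

HB.instance Definition _ := GRing.isSubmodClosed.Build R[i] (V -> W)%type
  bounded_operator_pred bounded_operator_submod_closed.

Record bounded_op := BoundedOp {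
  bounded_op_fun :> V -> W;
  bounded_op_prop : bounded_op_fun \in bounded_operator_pred }.

HB.instance Definition _ := [isSub for bounded_op_fun].
HB.instance Definition _ := [Choice of bounded_op by <:].
HB.instance Definition _ := [SubChoice_isSubLmodule of bounded_op by <:].

Lemma bounded_opP (T : bounded_op) : bounded_operator T.
Proof. by have /asboolP := bounded_op_prop T. Qed.

Lemma bounded_op_linear (T : bounded_op) : linear T.
Proof. by have [] := bounded_opP T. Qed.

HB.instance Definition _ (T : bounded_op) :=
  GRing.isLinear.Build R[i] V W *:%R T (bounded_op_linear T).

Implicit Types (T U : bounded_op) (x : V).

(* Norms take values in R[i], but suprema are only available in R: the
   supremum of the `|T x| is taken on real parts. *)
Definition op_norm_set (T : bounded_op) : set R :=
  [set complex.Re `|T x| | x in [set x : V | `|x| <= 1]].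

Definition op_norm (T : bounded_op) : R[i] := (sup (op_norm_set T))%:C.

Lemma op_norm_set_has_sup T : has_sup (op_norm_set T).
Proof.
split; first by exists (complex.Re `|T 0|); exists 0 => //=; rewrite normr0.
have [_ [M TM]] := bounded_opP T.
exists `|M| => _ [x /= x1 <-]; rewrite -lecR RRe_real//.
apply: (le_trans (TM x)).
apply: (@le_trans _ _ (`|M|%:C * `|x|)).
  by rewrite ler_wpM2r// lecR ler_norm.
by rewrite -[leRHS]mulr1 ler_wpM2l// ler0c.
Qed.

Lemma op_norm_ub T x : `|x| <= 1 -> `|T x| <= op_norm T.
Proof.
move=> x1; rewrite /op_norm -[leLHS]RRe_real// lecR.
by apply: ub_le_sup; [case: (op_norm_set_has_sup T) | exists x].
Qed.

Lemma op_norm_le T (M : R) :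
  (forall x, `|x| <= 1 -> `|T x| <= M%:C) -> op_norm T <= M%:C.
Proof.
move=> TM; rewrite lecR; apply: ge_sup; first by case: (op_norm_set_has_sup T).
by move=> _ [x /= /TM Tx <-]; rewrite -lecR RRe_real.
Qed.

Lemma op_norm_ge0 T : 0 <= op_norm T.
Proof. by apply: (@le_trans _ _ `|T 0|) => //; apply: op_norm_ub; rewrite normr0. Qed.

Lemma op_normP T x : `|T x| <= op_norm T * `|x|.
Proof.
have [->|x0] := eqVneq x 0; first by rewrite linear0 !normr0 mulr0.
have nx0 : 0 < `|x| by rewrite normr_gt0.
rewrite -ler_pdivrMr// mulrC -[X in X * _]ger0_norm; last by rewrite invr_ge0.
by rewrite -normrZ -linearZ op_norm_ub// normrZ ger0_norm ?invr_ge0// mulVf ?gt_eqF.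
Qed.

Lemma op_norm_real T : (complex.Re (op_norm T))%:C = op_norm T.
Proof. by rewrite RRe_real// ger0_real// op_norm_ge0. Qed.

Lemma op_normD T U : op_norm (T + U) <= op_norm T + op_norm U.
Proof.
rewrite -(op_norm_real T) -(op_norm_real U) -rmorphD; apply: op_norm_le => x x1.
rewrite rmorphD /= !op_norm_real.
by rewrite (le_trans (ler_normD _ _))// lerD// op_norm_ub.
Qed.

Lemma op_normZ_le (l : R[i]) T : op_norm (l *: T) <= `|l| * op_norm T.
Proof.
rewrite -(op_norm_real T) -[`|l|]RRe_real// -rmorphM; apply: op_norm_le => x x1.
rewrite rmorphM /= op_norm_real.
change (`|l *: T x| <= `|l| * op_norm T).
by rewrite normrZ ler_wpM2l// op_norm_ub.
Qed.

Lemma op_normZ (l : R[i]) T : op_norm (l *: T) = `|l| * op_norm T.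
Proof.
apply/eqP; rewrite eq_le op_normZ_le /=.
have [->|l0] := eqVneq l 0; first by rewrite normr0 mul0r op_norm_ge0.
rewrite -ler_pdivlMl ?normr_gt0// -[X in op_norm X <= _]scale1r.
by rewrite -(mulVf l0) -scalerA (le_trans (op_normZ_le _ _))// normfV.
Qed.

Lemma op_norm0_eq0 T : op_norm T = 0 -> T = 0.
Proof.
move=> T0; apply: val_inj; apply/funext => x /=.
apply/eqP; rewrite -normr_le0 (le_trans (op_normP T x))//.
by rewrite T0 mul0r.
Qed.

HB.instance Definition _ := Lmodule_isNormed.Build R[i] bounded_op
  op_normD op_normZ op_norm0_eq0.

End BoundedOperators.

Definition dual (R : realType) (X : normedModType R[i]) : normedModType R[i] :=
  bounded_op X R[i]^o.

Section OrthogonalityOfT.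
Context {R : realType} {X : normedModType R[i]} (T : bounded_op X (dual X)).
Implicit Types x y : X.

Definition T_orthogonal x y : Prop := T x y = 0.

Definition T_symmetric : Prop := forall x y, T x y = T y x.

Definition isotropic x : Prop := T x x = 0.

Definition nonisotropic x : Prop := ~ isotropic x.

Definition left_symmetric_at x : Prop :=
  forall y, T_orthogonal x y -> T_orthogonal y x.

Definition right_symmetric_at x : Prop :=
  forall y, T_orthogonal y x -> T_orthogonal x y.

End OrthogonalityOfT.

(* Main.v *)
Require Import Defs.
From HB Require Import structures.
From mathcomp Require Import all_boot all_order all_algebra.
From mathcomp Require Import complex ring.
From mathcomp Require Import all_classical all_reals all_analysis.

(** If [B y y <> 0], then [z - (B y z / B y y) y] is right orthogonal to [y], so
    left symmetry at [y] forces [B z y = B y z].  The vectors [y] satisfying this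
    identity for all [z] form a subspace.  It contains every nonisotropic vector,
    hence everything: if [x] is nonisotropic and [y] isotropic, then [x + y] and
    [x - y] cannot both be isotropic, since
    [B (x + y) (x + y) + B (x - y) (x - y) = 2 (B x x + B y y)].
    The right symmetric case is the left symmetric case for [fun x y => B y x]. *)

Import Order.TTheory GRing.Theory Num.Theory.
Import numFieldNormedType.Exports.
Local Open Scope ring_scope.
Local Open Scope complex_scope.

Section BilinearForm.
Context {K : numFieldType} {V : lmodType K} (B : V -> V -> K).
Hypothesis B_scalarl : forall z, scalar (B^~ z).
Hypothesis B_scalarr : forall z, scalar (B z).

Lemma form_addl x y z : B (x + y) z = B x z + B y z.
Proof. by have := B_scalarl z 1 x y; rewrite /= scale1r mul1r. Qed.

Lemma form_addr x y z : B z (x + y) = B z x + B z y.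
Proof. by have := B_scalarr z 1 x y; rewrite scale1r mul1r. Qed.

Lemma form_subl x y z : B (x - y) z = B x z - B y z.
Proof. by have := B_scalarl z (-1) y x; rewrite /= scaleN1r mulN1r ![- _ + _]addrC. Qed.

Lemma form_subr x y z : B z (x - y) = B z x - B z y.
Proof. by have := B_scalarr z (-1) y x; rewrite scaleN1r mulN1r ![- _ + _]addrC. Qed.

(** Polarization: symmetry turns [B (x + y) (x + y)] into [2 B x y] once the squares vanish, and 2
    is invertible in a [numFieldType]. *)
Lemma symmetric_alternating_form_eq0 :
  (forall x y, B x y = B y x) -> (forall x, B x x = 0) -> forall x y, B x y = 0.
Proof.
move=> B_sym B_alt x y; have := B_alt (x + y).
rewrite form_addl !form_addr !B_alt add0r addr0 (B_sym y x) -mulr2n.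
by move/eqP; rewrite mulrn_eq0 => /eqP.
Qed.

Lemma left_symmetric_form_comm y : B y y <> 0 ->
  (forall z, B y z = 0 -> B z y = 0) -> forall z, B y z = B z y.
Proof.
move=> /eqP yy_neq0 y_sym z; set c := - (B y z / B y y).
have := y_sym (c *: y + z).
(* Both expansions contain the same term [c * B y y = - B y z]. *)
rewrite B_scalarr (B_scalarl y c) /c mulNr divfK // addNr => /(_ erefl).
by move/eqP; rewrite addrC subr_eq0 => /eqP.
Qed.

Lemma left_symmetric_form_symmetric x : B x x <> 0 ->
  (forall y, B y y <> 0 -> forall z, B y z = 0 -> B z y = 0) ->
  forall y z, B y z = B z y.
Proof.
move=> xx_neq0 B_lsym y z.
have comm u : B u u <> 0 -> B u z = B z u.
  by move=> uu_neq0; apply: left_symmetric_form_comm => // v; apply: B_lsym.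
have [yy0|/eqP /comm //] := eqVneq (B y y) 0.
(* If [x + y] or [x - y] is nonisotropic, it commutes with [z]; so does [x], and cancelling it
   leaves the claim for [y]. *)
have [pp0|/eqP /comm] := eqVneq (B (x + y) (x + y)) 0; last first.
  by rewrite form_addl form_addr comm // => /addrI.
have [mm0|/eqP /comm] := eqVneq (B (x - y) (x - y)) 0; last first.
  by rewrite form_subl form_subr comm // => /addrI /oppr_inj.
(* Now [y], [x + y] and [x - y] are all isotropic, so the parallelogram identity gives
   [2 B x x = 0]. *)
case: xx_neq0.
have : B (x + y) (x + y) + B (x - y) (x - y) = (B x x + B y y) *+ 2.
  by rewrite form_subl !form_subr form_addl !form_addr; ring.
by rewrite pp0 mm0 yy0 !addr0 => /esym /eqP; rewrite mulrn_eq0 => /eqP.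
Qed.

End BilinearForm.

Section OperatorForm.
Context {R : realType} {X : normedModType R[i]} (T : bounded_op X (dual X)).

Lemma bounded_op_scalarl z : scalar (fun x => T x z).
Proof. by move=> a x y; rewrite linearP. Qed.

Lemma bounded_op_scalarr x : scalar (T x).
Proof. by move=> a y z; exact: (@linearP _ _ _ _ (T x : bounded_op X R[i]^o)). Qed.

(** Without a nonisotropic vector the form of [T] would be both symmetric and alternating, so [T]
    would vanish. *)
Lemma symmetric_nonisotropic :
  T != 0 -> T_symmetric T -> exists x, nonisotropic T x.
Proof.
move=> T_neq0 T_sym; apply: contrapT => T_isotropic.
move/eqP: T_neq0; apply; apply: val_inj; apply/funext => x /=.
apply: val_inj; apply/funext => y /=.
apply: (symmetric_alternating_form_eq0 (fun x y => T x y)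
  bounded_op_scalarl bounded_op_scalarr T_sym) => u.
by apply: contrapT => Tuu; apply: T_isotropic; exists u.
Qed.

End OperatorForm.

Theorem theorem2p9 (R : realType) (X : completeNormedModType R[i])
    (T : bounded_op X (dual X)) (T_neq0 : T != 0) :
  (T_symmetric T <->
     (exists x : X, nonisotropic T x) /\
     (forall y : X, nonisotropic T y -> left_symmetric_at T y)) /\
  (T_symmetric T <->
     (exists x : X, nonisotropic T x) /\
     (forall y : X, nonisotropic T y -> right_symmetric_at T y)).
Proof.
split; split.
- move=> T_sym; split; first exact: symmetric_nonisotropic.
  by move=> y _ z; rewrite /T_orthogonal T_sym.
- move=> [[x xx_neq0] T_lsym] y z.
  exact: (left_symmetric_form_symmetric (fun x y => T x y)
    (bounded_op_scalarl T) (bounded_op_scalarr T) x xx_neq0 T_lsym y z).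
- move=> T_sym; split; first exact: symmetric_nonisotropic.
  by move=> y _ z; rewrite /T_orthogonal T_sym.
- move=> [[x xx_neq0] T_rsym] y z.
  (* The flipped form exchanges the two linearity facts and the final arguments [z y]. *)
  exact: (left_symmetric_form_symmetric (fun x y => T y x)
    (bounded_op_scalarr T) (bounded_op_scalarl T) x xx_neq0 T_rsym z y).
Qed.
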